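(* There exist an integer $n$ and a graph $G$ on vertices $v_0,v_1,\ldots,v_{n-1}$ such that $\{v_i,v_{i+1}\}$ is an edge of $G$ for every $i\in\{0,\ldots,n-2\}$, $G$ is persistent (it satisfies both the X-property and the Bar-property), and there is no terrain $T$ with points $p_0,\ldots,p_{n-1}$ such that $G$ is the visibility graph of $T$ (with $v_i$ corresponding to $p_i$ for every $i$).
   Context: A terrain $T$ is an $x$-monotone polygonal chain in the plane with vertices (points) $p_0,p_1,\ldots,p_{n-1}$ listed from left to right, so the $x$-coordinates satisfy $p_0^x<p_1^x<\cdots<p_{n-1}^x$, and consecutive points are joined by segments. Two points $p_i,p_j$ ($i<j$) see each other iff the open segment $\overline{p_ip_j}$ lies strictly above $T$; equivalently, $j=i+1$ or every $p_k$ with $i<k<j$ lies strictly below the segment $\overline{p_ip_j}$. The visibility graph of $T$ has a vertex $v_i$ for each point $p_i$, and $\{v_i,v_j\}$ is an edge iff $p_i$ and $p_j$ see each other. For a graph $G$ on labeled vertices $v_0,\ldots,v_{n-1}$ in which each $\{v_i,v_{i+1}\}$ is an edge: the X-property says that for all $0\le a<b<c<d\le n-1$, if $\{v_a,v_c\}$ and $\{v_b,v_d\}$ are edges then $\{v_a,v_d\}$ is an edge; the Bar-property says that for every edge $\{v_i,v_k\}$ with $k\ge i+2$ there is $j$ with $i<j<k$ such that $\{v_i,v_j\}$ and $\{v_j,v_k\}$ are both edges. $G$ is persistent iff it satisfies both properties. *)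

(* Defs.v *)
From Stdlib Require Import Reals Lra Lia.
Open Scope R_scope.

(* A graph on vertices v_0,...,v_{n-1} is given by a relation E on indices
   (only the values on indices < n matter). *)

Definition is_graph (n : nat) (E : nat -> nat -> Prop) : Prop :=
  (forall i j, (i < n)%nat -> (j < n)%nat -> E i j -> E j i) /\
  (forall i, (i < n)%nat -> ~ E i i).

Definition has_path_edges (n : nat) (E : nat -> nat -> Prop) : Prop :=
  forall i, (i + 1 < n)%nat -> E i (i + 1)%nat.

Definition X_property (n : nat) (E : nat -> nat -> Prop) : Prop :=
  forall a b c d, (a < b)%nat -> (b < c)%nat -> (c < d)%nat -> (d < n)%nat ->
    E a c -> E b d -> E a d.

Definition Bar_property (n : nat) (E : nat -> nat -> Prop) : Prop :=
  forall i k, (i + 2 <= k)%nat -> (k < n)%nat -> E i k ->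
    exists j, (i < j)%nat /\ (j < k)%nat /\ E i j /\ E j k.

Definition persistent (n : nat) (E : nat -> nat -> Prop) : Prop :=
  X_property n E /\ Bar_property n E.

(* A terrain with points p_i = (x i, y i), i < n, x-coordinates strictly increasing. *)
Definition is_terrain (n : nat) (x y : nat -> R) : Prop :=
  forall i, (i + 1 < n)%nat -> x i < x (i + 1)%nat.

(* p_k lies strictly below the segment p_i p_j (for x i < x k < x j). *)
Definition strictly_below (x y : nat -> R) (i j k : nat) : Prop :=
  y k < y i + (y j - y i) * (x k - x i) / (x j - x i).

Definition sees (x y : nat -> R) (i j : nat) : Prop :=
  j = S i \/ (forall k, (i < k)%nat -> (k < j)%nat -> strictly_below x y i j k).

Definition is_visibility_graph (n : nat) (E : nat -> nat -> Prop) (x y : nat -> R) : Prop :=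
  forall i j, (i < j)%nat -> (j < n)%nat -> (E i j <-> sees x y i j).

(* Main.v *)
(** The constraints on slopes imposed by a visibility graph force inequalities between
    products of horizontal distances, and for the 24-vertex graph below these are
    contradictory.  Write [ij] for [x j - x i] and [s ij] for the slope of [p_i p_j].

    An edge [ik] gives [s ij < s ik < s jk] for [i < j < k]; edges [ij], [jk] without [ik]
    give [s jk <= s ij].  Call the cross-ratio [f(a,b,c,d) = [bc][ad] / ([ab][cd])].
    If the left points [a,b,c,d] satisfy [s bc <= s ab], then [s bd] is at most the average
    of [s cd] and [s ad] with weights [1 : f]; if the right points [a,b,c,d] satisfy
    [s cd <= s bc], then [s ac] is at least the average of [s ab] and [s ad] with weights
    [1 : f].  When the low and the high slopes on the left are bounded by those on the right,
    while the averaged slope on the right is at most that on the left, the product of the two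
    ratios is at most 1.  A triple of points works in the same way, with the plain ratio of
    its two distances.

    In the graph, this holds for [p = (3,4,10,11)] and [q = (12,13,19,20)], hence
    [f(p) f(q) <= 1].  It also holds for [(1,4,5)] with [(5,6,7,8)] and for [(6,7,8,9)] with
    [(9,10,11)]; as [f(5,6,7,8) f(6,7,8,9) > 1], these two give [f(p) > 1].  The graph is
    invariant under [i -> 23 - i], so [f(q) > 1] as well. *)

Require Import Defs.
From Stdlib Require Import Reals Lra Lia List Bool Arith.
Import ListNotations.
Open Scope R_scope.

(** * Slopes in a terrain *)

Definition slope (x y : nat -> R) (i j : nat) : R := (y j - y i) / (x j - x i).

Definition gap (x : nat -> R) (i j : nat) : R := x j - x i.

Lemma terrain_increasing (n : nat) (x y : nat -> R) :
  is_terrain n x y -> forall i j, (i < j)%nat -> (j < n)%nat -> x i < x j.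
Proof.
  intros Ht i j Hij; induction Hij as [|j Hij IH]; intros Hn.
  - specialize (Ht i); rewrite Nat.add_1_r in Ht; apply Ht; lia.
  - apply Rlt_trans with (x j); [apply IH; lia|].
    specialize (Ht j); rewrite Nat.add_1_r in Ht; apply Ht; lia.
Qed.

Lemma slope_gap (x y : nat -> R) (i j : nat) :
  x i < x j -> slope x y i j * gap x i j = y j - y i.
Proof. intros H; unfold slope, gap; field; lra. Qed.

Lemma slope_average (x y : nat -> R) (i j k : nat) :
  x i < x j -> x j < x k ->
  slope x y i k * gap x i k = slope x y i j * gap x i j + slope x y j k * gap x j k.
Proof. intros H1 H2; rewrite !slope_gap; lra. Qed.

Lemma slope_convex (x y : nat -> R) (i j k : nat) :
  x i < x j -> x j < x k ->
  slope x y i j < slope x y j k ->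
  slope x y i j < slope x y i k /\ slope x y i k < slope x y j k.
Proof.
  intros H1 H2 H; pose proof (slope_average x y i j k H1 H2) as A; unfold gap in A.
  split; apply Rmult_lt_reg_r with (x k - x i); nra.
Qed.

Lemma slope_convex_left (x y : nat -> R) (i j k : nat) :
  x i < x j -> x j < x k ->
  slope x y i j < slope x y i k -> slope x y i j < slope x y j k.
Proof.
  intros H1 H2 H; pose proof (slope_average x y i j k H1 H2) as A; unfold gap in A.
  apply Rmult_lt_reg_r with (x k - x j); nra.
Qed.

Lemma slope_convex_right (x y : nat -> R) (i j k : nat) :
  x i < x j -> x j < x k ->
  slope x y i k < slope x y j k -> slope x y i j < slope x y j k.
Proof.
  intros H1 H2 H; pose proof (slope_average x y i j k H1 H2) as A; unfold gap in A.
  apply Rmult_lt_reg_r with (x j - x i); nra.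
Qed.

Lemma strictly_below_slope (x y : nat -> R) (i j k : nat) :
  x i < x k -> (strictly_below x y i j k <-> slope x y i k < slope x y i j).
Proof.
  intros H; unfold strictly_below.
  replace ((y j - y i) * (x k - x i) / (x j - x i))
    with (slope x y i j * (x k - x i)) by (unfold slope, Rdiv; ring).
  pose proof (slope_gap x y i k H) as S; unfold gap in S.
  split; intros B.
  - apply Rmult_lt_reg_r with (x k - x i); lra.
  - apply Rmult_lt_compat_r with (r := x k - x i) in B; lra.
Qed.

Lemma visible_slopes (n : nat) (E : nat -> nat -> Prop) (x y : nat -> R) :
  is_terrain n x y -> is_visibility_graph n E x y ->
  forall i j k, (i < j)%nat -> (j < k)%nat -> (k < n)%nat -> E i k ->
    slope x y i j < slope x y i k /\ slope x y i k < slope x y j k.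
Proof.
  intros Ht Hv i j k Hij Hjk Hk He.
  assert (X1 : x i < x j) by (apply (terrain_increasing n x y Ht); lia).
  assert (X2 : x j < x k) by (apply (terrain_increasing n x y Ht); lia).
  apply (Hv i k ltac:(lia) Hk) in He; destruct He as [He|He]; [lia|].
  specialize (He j Hij Hjk); apply strictly_below_slope in He; [|exact X1].
  apply slope_convex; trivial.
  now apply slope_convex_left.
Qed.

(** If the chain turned upwards at [j], the segment from [i] to [k] would pass above the segments
    [ij] and [jk], which already lie above every point between their ends, so [ik] would be an
    edge. *)
Lemma blocked_slopes (n : nat) (E : nat -> nat -> Prop) (x y : nat -> R) :
  is_terrain n x y -> is_visibility_graph n E x y ->
  forall i j k, (i < j)%nat -> (j < k)%nat -> (k < n)%nat ->
    E i j -> E j k -> ~ E i k -> slope x y j k <= slope x y i j.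
Proof.
  intros Ht Hv i j k Hij Hjk Hk Eij Ejk Nik.
  destruct (Rle_or_lt (slope x y j k) (slope x y i j)) as [|Hlt]; [assumption|].
  pose proof (terrain_increasing n x y Ht) as Inc.
  assert (X1 : x i < x j) by (apply Inc; lia).
  assert (X2 : x j < x k) by (apply Inc; lia).
  destruct (slope_convex x y i j k X1 X2 Hlt) as [S1 S2].
  exfalso; apply Nik, (Hv i k ltac:(lia) Hk).
  right; intros m Him Hmk.
  apply strictly_below_slope; [apply Inc; lia|].
  destruct (lt_eq_lt_dec m j) as [[Hmj| ->]|Hjm].
  - destruct (visible_slopes n E x y Ht Hv i m j) as [S _]; trivial; [lia|lra].
  - exact S1.
  (* Beyond [j] the comparison is made at the right end: [s ik < s jk < s mk] puts [m] below the
     segment [ik]. *)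
  - destruct (visible_slopes n E x y Ht Hv j m k) as [_ S]; trivial.
    assert (X3 : x i < x m) by (apply Inc; lia).
    assert (X4 : x m < x k) by (apply Inc; lia).
    apply (slope_convex x y i m k X3 X4), slope_convex_right; trivial; lra.
Qed.

(** * Distance inequalities forced by slope inequalities *)

(* The two sides differ by [[ab] * [bc] * (s ab - s bc)]; Ptolemy's relation
   [[bc][ad] + [ab][cd] = [ac][bd]] clears the denominators. *)
Lemma left_quadruple_average (x y : nat -> R) (a b c d : nat) :
  x a < x b -> x b < x c -> x c < x d ->
  slope x y b c <= slope x y a b ->
  slope x y b d * (gap x b c * gap x a d + gap x a b * gap x c d) <=
  slope x y c d * (gap x a b * gap x c d) + slope x y a d * (gap x b c * gap x a d).
Proof.
  intros H1 H2 H3 H.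
  pose proof (slope_average x y b c d H2 H3) as A1.
  pose proof (slope_average x y a b d H1 (Rlt_trans _ _ _ H2 H3)) as A2.
  replace (gap x b c * gap x a d + gap x a b * gap x c d)
    with (gap x b d * gap x a c) by (unfold gap; ring).
  replace (slope x y b d * (gap x b d * gap x a c))
    with ((slope x y b d * gap x b d) * gap x a c) by ring.
  replace (slope x y a d * (gap x b c * gap x a d))
    with ((slope x y a d * gap x a d) * gap x b c) by ring.
  rewrite A2, A1.
  assert (P : 0 <= gap x a b * gap x b c * (slope x y a b - slope x y b c)).
  { apply Rmult_le_pos; [apply Rmult_le_pos|]; unfold gap; lra. }
  replace (gap x a c) with (gap x a b + gap x b c) by (unfold gap; ring).
  nra.
Qed.

(** Mirror image of [left_quadruple_average]; here the two sides differ by [[bc] * [cd] * (s bc - s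
    cd)]. *)
Lemma right_quadruple_average (x y : nat -> R) (a b c d : nat) :
  x a < x b -> x b < x c -> x c < x d ->
  slope x y c d <= slope x y b c ->
  slope x y a b * (gap x a b * gap x c d) + slope x y a d * (gap x b c * gap x a d) <=
  slope x y a c * (gap x b c * gap x a d + gap x a b * gap x c d).
Proof.
  intros H1 H2 H3 H.
  pose proof (slope_average x y a b c H1 H2) as A1.
  pose proof (slope_average x y a c d (Rlt_trans _ _ _ H1 H2) H3) as A2.
  replace (gap x b c * gap x a d + gap x a b * gap x c d)
    with (gap x a c * gap x b d) by (unfold gap; ring).
  replace (slope x y a c * (gap x a c * gap x b d))
    with ((slope x y a c * gap x a c) * gap x b d) by ring.
  replace (slope x y a d * (gap x b c * gap x a d))
    with ((slope x y a d * gap x a d) * gap x b c) by ring.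
  rewrite A2, A1.
  assert (P : 0 <= gap x b c * gap x c d * (slope x y b c - slope x y c d)).
  { apply Rmult_le_pos; [apply Rmult_le_pos|]; unfold gap; lra. }
  replace (gap x b d) with (gap x b c + gap x c d) by (unfold gap; ring).
  nra.
Qed.

(** Measured as a fraction of the way from [lo'] to [hi'], [t] is at most [u / (u + w)] and [s] at
    least [w' / (u' + w')]; since [s <= t], these fractions are ordered. *)
Lemma weights_of_averages (lo hi lo' hi' s t u w u' w' : R) :
  0 < u -> 0 < w -> 0 < u' -> 0 < w' ->
  lo <= lo' -> hi <= hi' -> lo' < hi' -> s <= t ->
  t * (w + u) <= hi * u + lo * w ->
  lo' * u' + hi' * w' <= s * (w' + u') ->
  w * w' <= u * u'.
Proof.
  intros Hu Hw Hu' Hw' Hlo Hhi Hlt Hst Ht Hs.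
  assert (T : t * (w + u) <= hi' * u + lo' * w) by nra.
  assert (S : lo' * u' + hi' * w' <= t * (w' + u')) by nra.
  assert (C : (lo' * u' + hi' * w') * (w + u) <= (hi' * u + lo' * w) * (w' + u')) by nra.
  (* The two sides of [C] differ by [(hi' - lo') * (u * u' - w * w')]. *)
  apply Rmult_le_reg_r with (hi' - lo'); nra.
Qed.

Lemma quadruple_quadruple (x y : nat -> R) (a b c d a' b' c' d' : nat) :
  x a < x b -> x b < x c -> x c < x d ->
  x a' < x b' -> x b' < x c' -> x c' < x d' ->
  slope x y b c <= slope x y a b ->
  slope x y c' d' <= slope x y b' c' ->
  slope x y a d <= slope x y a' b' ->
  slope x y c d <= slope x y a' d' ->
  slope x y a' b' < slope x y a' d' ->
  slope x y a' c' <= slope x y b d ->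
  (gap x b c * gap x a d) * (gap x b' c' * gap x a' d') <=
  (gap x a b * gap x c d) * (gap x a' b' * gap x c' d').
Proof.
  intros H1 H2 H3 H1' H2' H3' S S' Lo Hi Lt St.
  apply (weights_of_averages (slope x y a d) (slope x y c d) (slope x y a' b')
           (slope x y a' d') (slope x y a' c') (slope x y b d)); trivial;
    try (apply Rmult_lt_0_compat; unfold gap; lra).
  - now apply left_quadruple_average.
  - now apply right_quadruple_average.
Qed.

Lemma triple_quadruple (x y : nat -> R) (a b c a' b' c' d' : nat) :
  x a < x b -> x b < x c ->
  x a' < x b' -> x b' < x c' -> x c' < x d' ->
  slope x y c' d' <= slope x y b' c' ->
  slope x y a b <= slope x y a' b' ->
  slope x y b c <= slope x y a' d' ->
  slope x y a' b' < slope x y a' d' ->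
  slope x y a' c' <= slope x y a c ->
  gap x a b * (gap x b' c' * gap x a' d') <= gap x b c * (gap x a' b' * gap x c' d').
Proof.
  intros H1 H2 H1' H2' H3' S' Lo Hi Lt St.
  apply (weights_of_averages (slope x y a b) (slope x y b c) (slope x y a' b')
           (slope x y a' d') (slope x y a' c') (slope x y a c)); trivial;
    try (apply Rmult_lt_0_compat); unfold gap; try lra.
  - pose proof (slope_average x y a b c H1 H2) as A; unfold gap in A; lra.
  - now apply right_quadruple_average.
Qed.

Lemma quadruple_triple (x y : nat -> R) (a b c d a' b' c' : nat) :
  x a < x b -> x b < x c -> x c < x d ->
  x a' < x b' -> x b' < x c' ->
  slope x y b c <= slope x y a b ->
  slope x y a d <= slope x y a' b' ->
  slope x y c d <= slope x y b' c' ->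
  slope x y a' b' < slope x y b' c' ->
  slope x y a' c' <= slope x y b d ->
  (gap x b c * gap x a d) * gap x b' c' <= (gap x a b * gap x c d) * gap x a' b'.
Proof.
  intros H1 H2 H3 H1' H2' S Lo Hi Lt St.
  apply (weights_of_averages (slope x y a d) (slope x y c d) (slope x y a' b')
           (slope x y b' c') (slope x y a' c') (slope x y b d)); trivial;
    try (apply Rmult_lt_0_compat); unfold gap; try lra.
  - now apply left_quadruple_average.
  - pose proof (slope_average x y a' b' c' H1' H2') as A; unfold gap in A; lra.
Qed.

(* In the product of the two hypotheses [a3 - a2] and [a4 - a3] cancel, and what remains of
   [f(a1,a2,a3,a4) f(a2,a3,a4,a5)] is [[a1 a4][a2 a5] / ([a1 a2][a4 a5]) > 1]. *)
Lemma cross_ratio_gt_1 (z p1 p2 a1 a2 a3 a4 a5 p3 p4 : R) :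
  z < p1 -> p1 < p2 -> p2 < a1 -> a1 < a2 -> a2 < a3 -> a3 < a4 -> a4 < a5 ->
  a5 < p3 -> p3 < p4 ->
  (p2 - z) * ((a3 - a2) * (a4 - a1)) <= (a1 - p2) * ((a2 - a1) * (a4 - a3)) ->
  ((a4 - a3) * (a5 - a2)) * (p4 - p3) <= ((a3 - a2) * (a5 - a4)) * (p3 - a5) ->
  (p2 - p1) * (p4 - p3) < (p3 - p2) * (p4 - p1).
Proof.
  intros H1 H2 H3 H4 H5 H6 H7 H8 H9 I J.
  assert (K : ((p2 - z) * (p4 - p3)) * ((a4 - a1) * (a5 - a2)) <=
              ((a1 - p2) * (p3 - a5)) * ((a2 - a1) * (a5 - a4))).
  { apply Rmult_le_reg_r with ((a3 - a2) * (a4 - a3));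
      [apply Rmult_lt_0_compat; lra|].
    replace ((p2 - z) * (p4 - p3) * ((a4 - a1) * (a5 - a2)) * ((a3 - a2) * (a4 - a3)))
      with (((p2 - z) * ((a3 - a2) * (a4 - a1))) *
            (((a4 - a3) * (a5 - a2)) * (p4 - p3))) by ring.
    replace ((a1 - p2) * (p3 - a5) * ((a2 - a1) * (a5 - a4)) * ((a3 - a2) * (a4 - a3)))
      with (((a1 - p2) * ((a2 - a1) * (a4 - a3))) *
            (((a3 - a2) * (a5 - a4)) * (p3 - a5))) by ring.
    apply Rmult_le_compat; trivial;
      repeat (apply Rmult_le_pos); lra. }
  assert (L : (p2 - z) * (p4 - p3) < (a1 - p2) * (p3 - a5)).
  { assert (C : (a2 - a1) * (a5 - a4) < (a4 - a1) * (a5 - a2))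
      by (apply Rmult_le_0_lt_compat; lra).
    assert (P : 0 < (a1 - p2) * (p3 - a5)) by (apply Rmult_lt_0_compat; lra).
    assert (Q : 0 < (a4 - a1) * (a5 - a2)) by (apply Rmult_lt_0_compat; lra).
    apply Rmult_lt_reg_r with ((a4 - a1) * (a5 - a2)); [exact Q|].
    eapply Rle_lt_trans; [exact K|].
    now apply Rmult_lt_compat_l. }
  (* [M] and [N] only compare nested intervals: [p1] lies between [z] and [p2], and all [ai] lie
     between [p2] and [p3]. *)
  assert (M : (p2 - p1) * (p4 - p3) <= (p2 - z) * (p4 - p3))
    by (apply Rmult_le_compat_r; lra).
  assert (N : (a1 - p2) * (p3 - a5) <= (p3 - p2) * (p4 - p1))
    by (apply Rmult_le_compat; lra).
  lra.
Qed.

(** * The graph *)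

(* Found by a SAT search for a persistent graph that satisfies the slope comparisons used in
   [adj_not_terrain]. *)
Definition right_neighbours (i : nat) : list nat :=
  match i with
  | 0 => 1 :: seq 5 19
  | 1 => seq 2 4 ++ seq 8 16
  | 2 => 3 :: seq 12 12
  | 3 => [4; 11; 12] ++ seq 14 10
  | 4 => [5; 8; 9; 10; 11] ++ seq 20 4
  | 5 => seq 6 6 ++ seq 20 4
  | 6 => [7; 9; 10; 11] ++ seq 20 4
  | 7 => [8; 9] ++ seq 20 4
  | 8 => 9 :: seq 20 4
  | 9 => [10; 11] ++ seq 20 4
  | 10 => 11 :: seq 21 3
  | 11 => 12 :: seq 20 4
  | 12 => [13; 14; 17; 18; 19; 20; 22; 23]
  | 13 => [14; 17; 18; 19; 22; 23]
  | 14 => seq 15 5 ++ [22; 23]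
  | 15 => [16; 18; 19; 22; 23]
  | 16 => [17; 18; 23]
  | 17 => [18; 23]
  | 18 => [19; 22; 23]
  | 19 => [20; 22]
  | 20 => [21; 22]
  | 21 => [22]
  | 22 => [23]
  | _ => []
  end%nat.

Definition adjb (i j : nat) : bool :=
  existsb (Nat.eqb (Nat.max i j)) (right_neighbours (Nat.min i j)).

Definition adj (i j : nat) : Prop := adjb i j = true.

Lemma forallb_below (n : nat) (f : nat -> bool) :
  forallb f (seq 0 n) = true -> forall i, (i < n)%nat -> f i = true.
Proof. intros H i Hi; rewrite forallb_forall in H; apply H, in_seq; lia. Qed.

(** * Persistence, by exhaustive computation *)

Lemma adj_is_graph : is_graph 24 adj.
Proof.
  split.
  - intros i j _ _; unfold adj, adjb; now rewrite Nat.max_comm, Nat.min_comm.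
  - intros i Hi.
    assert (C : forallb (fun i => negb (adjb i i)) (seq 0 24) = true)
      by (vm_compute; reflexivity).
    apply forallb_below with (i := i) in C; [|exact Hi].
    unfold adj; now destruct (adjb i i).
Qed.

Lemma adj_path_edges : has_path_edges 24 adj.
Proof.
  intros i Hi.
  assert (C : forallb (fun i => adjb i (i + 1)) (seq 0 23) = true)
    by (vm_compute; reflexivity).
  apply forallb_below with (i := i) in C; [exact C|lia].
Qed.

Lemma adj_X_property : X_property 24 adj.
Proof.
  (* The largest index is outermost, so each range is an initial segment and [forallb_below] peels
     it off. *)
  assert (C : forallb (fun d => forallb (fun c => forallb (fun b => forallb (fun a =>
                implb (adjb a c && adjb b d) (adjb a d))
                (seq 0 b)) (seq 0 c)) (seq 0 d)) (seq 0 24) = true)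
    by (vm_compute; reflexivity).
  intros a b c d Hab Hbc Hcd Hd Eac Ebd; unfold adj in *.
  apply forallb_below with (i := d) in C; [|exact Hd].
  apply forallb_below with (i := c) in C; [|exact Hcd].
  apply forallb_below with (i := b) in C; [|exact Hbc].
  apply forallb_below with (i := a) in C; [|exact Hab].
  now rewrite Eac, Ebd in C.
Qed.

Lemma adj_Bar_property : Bar_property 24 adj.
Proof.
  assert (C : forallb (fun k => forallb (fun i =>
                implb (adjb i k)
                  (existsb (fun j => adjb i j && adjb j k) (seq (i + 1) (k - i - 1))))
                (seq 0 (k - 1))) (seq 0 24) = true)
    by (vm_compute; reflexivity).
  intros i k Hik Hk Eik; unfold adj in *.
  apply forallb_below with (i := k) in C; [|exact Hk].
  apply forallb_below with (i := i) in C; [|lia].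
  rewrite Eik in C; simpl in C.
  apply existsb_exists in C as [j [Hj C]].
  apply in_seq in Hj; apply andb_prop in C as [C1 C2].
  exists j; repeat split; trivial; lia.
Qed.

(** * Contradictory distances in a terrain with this graph *)

Lemma adj_not_terrain (x y : nat -> R) :
  is_terrain 24 x y -> ~ is_visibility_graph 24 adj x y.
Proof.
  intros Ht Hg.
  (* Boolean side conditions in [Inc], [V] and [B] let [eq_refl] check indices and adjacency by
     computation. *)
  assert (Inc : forall i j, ((i <? j) && (j <? 24))%nat = true -> x i < x j).
  { intros i j H; apply andb_prop in H as [H1 H2].
    apply Nat.ltb_lt in H1, H2; now apply (terrain_increasing 24 x y). }
  assert (V : forall i j k, ((i <? j) && (j <? k) && (k <? 24))%nat && adjb i k = true ->
            slope x y i j < slope x y i k /\ slope x y i k < slope x y j k).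
  { intros i j k H; rewrite !andb_true_iff, !Nat.ltb_lt in H.
    destruct H as [[[H1 H2] H3] H4]; now apply (visible_slopes 24 adj). }
  assert (B : forall i j k, ((i <? j) && (j <? k) && (k <? 24))%nat &&
              (adjb i j && adjb j k && negb (adjb i k)) = true ->
            slope x y j k <= slope x y i j).
  { intros i j k H; rewrite !andb_true_iff, negb_true_iff, !Nat.ltb_lt in H.
    destruct H as [[[H1 H2] H3] [[H4 H5] H6]]; apply (blocked_slopes 24 adj); trivial.
    unfold adj; congruence. }
  assert (PQ : (gap x 4 10 * gap x 3 11) * (gap x 13 19 * gap x 12 20) <=
               (gap x 3 4 * gap x 10 11) * (gap x 12 13 * gap x 19 20)).
  { apply (quadruple_quadruple x y); try (apply Inc; reflexivity).
    - apply (B 3 4 10)%nat; reflexivity.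
    - apply (B 13 19 20)%nat; reflexivity.
    (* Point 2 links the low slopes: [s(3,11) <= s(2,3) < s(2,12) < s(12,13)]. *)
    - pose proof (B 2 3 11 eq_refl)%nat; pose proof (V 2 3 12 eq_refl)%nat.
      pose proof (V 2 12 13 eq_refl)%nat; lra.
    (* Point 21 links the high slopes: [s(10,11) < s(10,21) < s(20,21) <= s(12,20)]. *)
    - pose proof (V 10 11 21 eq_refl)%nat; pose proof (V 10 20 21 eq_refl)%nat.
      pose proof (B 12 20 21 eq_refl)%nat; lra.
    - apply (V 12 13 20)%nat; reflexivity.
    - pose proof (B 11 12 19 eq_refl)%nat; pose proof (B 4 11 12 eq_refl)%nat; lra. }
  assert (XV : gap x 1 4 * (gap x 6 7 * gap x 5 8) <= gap x 4 5 * (gap x 5 6 * gap x 7 8)).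
  { apply (triple_quadruple x y); try (apply Inc; reflexivity).
    - apply (B 6 7 8)%nat; reflexivity.
    - pose proof (B 0 1 4 eq_refl)%nat; pose proof (V 0 1 5 eq_refl)%nat.
      pose proof (V 0 5 6 eq_refl)%nat; lra.
    - pose proof (V 4 5 8 eq_refl)%nat; lra.
    - apply (V 5 6 8)%nat; reflexivity.
    - apply (B 1 5 7)%nat; reflexivity. }
  assert (TU : (gap x 7 8 * gap x 6 9) * gap x 10 11 <= (gap x 6 7 * gap x 8 9) * gap x 9 10).
  { apply (quadruple_triple x y); try (apply Inc; reflexivity).
    - apply (B 6 7 8)%nat; reflexivity.
    - pose proof (V 6 9 10 eq_refl)%nat; lra.
    - pose proof (V 8 9 20 eq_refl)%nat; pose proof (V 8 11 20 eq_refl)%nat.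
      pose proof (B 10 11 20 eq_refl)%nat; lra.
    - pose proof (V 9 10 11 eq_refl)%nat; lra.
    - apply (B 7 9 11)%nat; reflexivity. }
  (* [XV'] and [TU'] mirror [XV] and [TU] under [i -> 23 - i], which swaps left and right and hence
     the two triple lemmas. *)
  assert (XV' : (gap x 16 17 * gap x 15 18) * gap x 19 22 <=
                (gap x 15 16 * gap x 17 18) * gap x 18 19).
  { apply (quadruple_triple x y); try (apply Inc; reflexivity).
    - apply (B 15 16 17)%nat; reflexivity.
    - pose proof (V 15 18 19 eq_refl)%nat; lra.
    - pose proof (V 17 18 23 eq_refl)%nat; pose proof (V 17 22 23 eq_refl)%nat.
      pose proof (B 19 22 23 eq_refl)%nat; lra.
    - pose proof (V 18 19 22 eq_refl)%nat; lra.
    - apply (B 16 18 22)%nat; reflexivity. }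
  assert (TU' : gap x 12 13 * (gap x 15 16 * gap x 14 17) <=
                gap x 13 14 * (gap x 14 15 * gap x 16 17)).
  { apply (triple_quadruple x y); try (apply Inc; reflexivity).
    - apply (B 15 16 17)%nat; reflexivity.
    - pose proof (B 3 12 13 eq_refl)%nat; pose proof (V 3 12 14 eq_refl)%nat.
      pose proof (V 3 14 15 eq_refl)%nat; lra.
    - pose proof (V 13 14 17 eq_refl)%nat; lra.
    - apply (V 14 15 17)%nat; reflexivity.
    - apply (B 12 14 16)%nat; reflexivity. }
  assert (P : gap x 3 4 * gap x 10 11 < gap x 4 10 * gap x 3 11).
  { apply (cross_ratio_gt_1 (x 1%nat) (x 3%nat) (x 4%nat) (x 5%nat) (x 6%nat) (x 7%nat)
             (x 8%nat) (x 9%nat) (x 10%nat) (x 11%nat)); trivial; apply Inc; reflexivity. }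
  (* Negating the coordinates restores the increasing order of the mirrored points, so
     [cross_ratio_gt_1] applies again. *)
  assert (Neg : forall i j, ((i <? j) && (j <? 24))%nat = true -> - x j < - x i)
    by (intros i j H; apply Ropp_lt_contravar, Inc, H).
  assert (Q : gap x 12 13 * gap x 19 20 < gap x 13 19 * gap x 12 20).
  { unfold gap in *.
    pose proof (cross_ratio_gt_1 (- x 22%nat) (- x 20%nat) (- x 19%nat) (- x 18%nat)
             (- x 17%nat) (- x 16%nat) (- x 15%nat) (- x 14%nat) (- x 13%nat) (- x 12%nat)) as C.
    assert (D : (- x 19%nat - - x 20%nat) * (- x 12%nat - - x 13%nat) <
                (- x 13%nat - - x 19%nat) * (- x 12%nat - - x 20%nat)).
    { apply C; try (apply Neg; reflexivity).
      - eapply Rle_trans; [|eapply Rle_trans; [exact XV'|]]; apply Req_le; ring.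
      - eapply Rle_trans; [|eapply Rle_trans; [exact TU'|]]; apply Req_le; ring. }
    eapply Rle_lt_trans; [|eapply Rlt_le_trans; [exact D|]]; apply Req_le; ring. }
  assert (Pos : forall i j, ((i <? j) && (j <? 24))%nat = true -> 0 <= gap x i j)
    by (intros i j H; apply Inc in H; unfold gap; lra).
  apply (Rlt_irrefl ((gap x 4 10 * gap x 3 11) * (gap x 13 19 * gap x 12 20))).
  eapply Rle_lt_trans; [exact PQ|].
  apply Rmult_le_0_lt_compat; trivial; apply Rmult_le_pos; apply Pos; reflexivity.
Qed.

Theorem theorem1 :
  exists (n : nat) (E : nat -> nat -> Prop),
    is_graph n E /\ has_path_edges n E /\ persistent n E /\
    ~ (exists x y : nat -> R, is_terrain n x y /\ is_visibility_graph n E x y).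
Proof.
  exists 24%nat, adj; split; [exact adj_is_graph|].
  split; [exact adj_path_edges|].
  split; [exact (conj adj_X_property adj_Bar_property)|].
  intros [x [y [Ht Hv]]]; exact (adj_not_terrain x y Ht Hv).
Qed.
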